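(* Let $m\geq 1$ be an integer, $p\in(0,1)$, $q=1-p$. For fixed $i\geq 1$, $$\sum_{n\ge 0}u^n\,\mathbb{E}_{\nu^{(p)}_{n,m}}[N_i]=\frac{1}{1-u}\sum_{r\ge 1}\frac{B^{(m,p)}_{i,r}}{i}u^{ir}$$ as formal power series in $u$. In particular, $$\mathbb{E}_{\nu^{(p)}_{n,m}}[N_i]=\frac1i\sum_{r=1}^{\lfloor n/i\rfloor}B^{(m,p)}_{i,r}.$$
   Context: Asymmetric shelf shuffle: let $m\ge 1$ be an integer, $p\in(0,1)$, $q=1-p$. A deck of $n$ cards labelled $1,\ldots,n$ from top to bottom is dealt sequentially from the bottom (card $n$ first, card $1$ last). Each card is assigned to one of $m$ labelled shelves independently and uniformly at random, and is placed at the top of the existing pile on that shelf with probability $p$ and at the bottom with probability $q$, independently of everything else. The shuffled deck is formed by joining the piles in shelf order (shelf $1$ on top, then shelf $2$, and so on). The resulting random permutation is $\pi=(\pi_1,\ldots,\pi_n)\in S_n$, where $\pi_i$ is the label of the card in position $i$ from the top, and $\nu^{(p)}_{n,m}$ denotes its law on $S_n$. For $\pi\in S_n$, $N_i(\pi)$ is the number of cycles of length $i$ of $\pi$ (for $n=0$ the permutation is empty and $N_i=0$). For $i,r\ge1$, $$B^{(m,p)}_{i,r}:=\sum_{d\mid i}\mu(d)\, m^{\,i/d-ir}\bigl(p^{dr}-(-q)^{dr}\bigr)^{i/d},$$ where $\mu$ is the number-theoretic Möbius function. *)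

(* Defs.v *)
From mathcomp Require Import all_boot all_order all_algebra all_fingroup.

Set Implicit Arguments.
Unset Strict Implicit.
Unset Printing Implicit Defensive.

Import Order.TTheory GRing.Theory Num.Theory.

Local Open Scope ring_scope.

(* A formal power series is its sequence of coefficients. *)
Definition fps (R : Type) := nat -> R.

Section FormalPowerSeries.

Variable F : fieldType.
Implicit Types (f g : fps F) (a : nat -> fps F).

(* c * u ^ k *)
Definition fps_mono (c : F) (k : nat) : fps F := fun n => if n == k then c else 0.

Definition fps_sub f g : fps F := fun n => f n - g n.

Definition fps_mul f g : fps F := fun n => \sum_(k < n.+1) f k * g (n - k)%N.

(* The first n coefficients g_0, ..., g_(n-1) of the inverse g of f, obtained
   by solving f_0 g_n = [n = 0] - \sum_(k < n) f_(n-k) g_k. *)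
Fixpoint fps_inv_coefs f (n : nat) : seq F :=
  if n is n'.+1 then
    let s := fps_inv_coefs f n' in
    rcons s ((f 0%N)^-1 * ((n' == 0%N)%:R - \sum_(k < n') f (n' - k)%N * s`_k))
  else [::].

Definition fps_inv f : fps F := fun n => (fps_inv_coefs f n.+1)`_n.

(* The infinite sum \sum_(k >= k0) a_k of a family of series such that u ^ k
   divides a_k for every k: the coefficient of u ^ n then only involves the
   a_k with k <= n. It is meaningful for such families only. *)
Definition fps_sum (k0 : nat) a : fps F := fun n => \sum_(k0 <= k < n.+1) a k n.

Lemma size_fps_inv_coefs f n : size (fps_inv_coefs f n) = n.
Proof. by elim: n => //= n IHn; rewrite size_rcons IHn. Qed.

Lemma nth_fps_inv_coefs f n k : (k < n)%N -> (fps_inv_coefs f n)`_k = fps_inv f k.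
Proof.
elim: n => // n IHn; rewrite ltnS leq_eqVlt => /predU1P[-> // | ltkn].
by rewrite /= nth_rcons size_fps_inv_coefs ltkn IHn.
Qed.

Lemma fps_mulV f : f 0%N != 0 -> fps_mul f (fps_inv f) =1 fps_mono 1 0.
Proof.
move=> f0 n; rewrite /fps_mul (reindex_inj rev_ord_inj) /= big_ord_recr /=.
rewrite subSS subnn subn0 {2}/fps_inv /= nth_rcons size_fps_inv_coefs ltnn eqxx.
rewrite mulrA divff // mul1r.
under [X in X + _]eq_bigr => k _ do
  rewrite subSS (subKn (ltnW (ltn_ord k))) -(nth_fps_inv_coefs f (ltn_ord k)).
by rewrite addrC subrK /fps_mono; case: (n == 0%N).
Qed.

End FormalPowerSeries.

(* Cards and positions are numbered from 0: card (or position) j : 'I_n stands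
   for card (or position) j + 1. A pile is listed from top to bottom. *)
Section ShelfShuffle.

Variables (n m : nat).

(* For every card, its shelf and whether it goes on top (true) or at the
   bottom (false) of the pile on that shelf. *)
Definition shelf_choices := {ffun 'I_n -> 'I_m * bool}.

Definition deal_card (w : shelf_choices) (piles : 'I_m -> seq 'I_n) (c : 'I_n) :
    'I_m -> seq 'I_n :=
  fun s => if s == (w c).1
           then if (w c).2 then c :: piles s else rcons (piles s) c
           else piles s.

(* The cards are dealt from the bottom of the deck. *)
Definition shelf_piles (w : shelf_choices) : 'I_m -> seq 'I_n :=
  foldl (deal_card w) (fun=> [::]) (rev (enum 'I_n)).

Definition shuffled_deck (w : shelf_choices) : seq 'I_n :=
  flatten [seq shelf_piles w s | s <- enum 'I_m].

End ShelfShuffle.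

Section ShelfLaw.

Variables (R : realFieldType) (n m : nat) (p : R).

(* The cards choose independently: a uniform shelf, and the top with
   probability p. *)
Definition shelf_weight (w : shelf_choices n m) : R :=
  \prod_(c : 'I_n) (m%:R^-1 * (if (w c).2 then p else 1 - p)).

(* nu s is the probability that, for all j, the card in position j of the
   shuffled deck is s j. *)
Definition nu (s : 'S_n) : R :=
  \sum_(w : shelf_choices n m | shuffled_deck w == [seq s j | j <- enum 'I_n])
     shelf_weight w.

Definition nu_expectation (X : 'S_n -> R) : R := \sum_(s : 'S_n) nu s * X s.

End ShelfLaw.

Lemma perm_shuffled_deck n m (w : shelf_choices n m) :
  perm_eq (shuffled_deck w) (enum 'I_n).
Proof.
have deal (l : seq 'I_n) (piles : 'I_m -> seq 'I_n) :
  perm_eq (flatten [seq foldl (deal_card w) piles l s | s <- enum 'I_m])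
          (l ++ flatten [seq piles s | s <- enum 'I_m]).
  elim: l piles => [|c l IHl] piles //=.
  apply: perm_trans (IHl _) _.
  rewrite -[_ :: _ ++ _]cat1s perm_sym perm_catCA perm_cat2l perm_sym.
  apply/seq.permP => P; rewrite /= !count_flatten -!map_comp !sumnE !big_map -enumT !big_enum /=.
  rewrite (bigD1 (w c).1) //= [in RHS](bigD1 (w c).1) //= /deal_card eqxx addnA.
  congr (_ + _)%N; first by case: (w c).2; rewrite //= -cats1 count_cat /= addn0 addnC.
  by apply: eq_bigr => s /negPf ->.
apply: perm_trans (deal _ _) _.
have -> : flatten [seq [::] | _ <- enum 'I_m] = [::] :> seq 'I_n by elim: (enum 'I_m).
by rewrite cats0 perm_rev.
Qed.

Lemma sum_nu (R : realFieldType) (n m : nat) (p : R) :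
  (0 < m)%N -> \sum_(s : 'S_n) nu m p s = 1.
Proof.
move=> m_gt0; rewrite /nu (exchange_big_dep xpredT) //=.
have deckE (w : shelf_choices n m) : exists s0 : 'S_n,
    (fun s : 'S_n => shuffled_deck w == [seq s j | j <- enum 'I_n]) =1 pred1 s0.
  have deckP := perm_shuffled_deck w.
  have szd : size (shuffled_deck w) = n by rewrite (perm_size deckP) size_enum_ord.
  have uniqd : uniq (shuffled_deck w) by rewrite (perm_uniq deckP) enum_uniq.
  pose f (j : 'I_n) := nth j (shuffled_deck w) j.
  have f_inj : injective f.
    move=> j k; rewrite /f (set_nth_default k) ?szd // => /eqP.
    by rewrite nth_uniq ?szd // => /eqP/val_inj.
  have defd : shuffled_deck w = [seq perm f_inj j | j <- enum 'I_n].
    case: n w @f f_inj szd {deckP uniqd} => [|n'] w f f_inj szd.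
      by rewrite (size0nil szd); apply/esym/size0nil; rewrite size_map size_enum_ord.
    apply: (@eq_from_nth _ ord0) => [|k]; first by rewrite size_map size_enum_ord szd.
    rewrite szd => ltk; rewrite (nth_map ord0) ?size_enum_ord // permE /f.
    by rewrite nth_enum_ord //; apply: set_nth_default; rewrite szd.
  exists (perm f_inj) => s /=; apply/eqP/eqP => [|-> //].
  rewrite defd => /eq_in_map eqs; apply/permP => j.
  by rewrite eqs ?mem_enum.
rewrite (eq_bigr (fun w => shelf_weight p w)); last first.
  by move=> w _; have [s0 es] := deckE w; rewrite (eq_bigl _ _ es) big_pred1_eq.
rewrite /shelf_weight.
rewrite -(bigA_distr_bigA (fun _ (x : 'I_m * bool) => m%:R^-1 * (if x.2 then p else 1 - p))).
rewrite big1 // => c _.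
rewrite -(pair_bigA _ (fun (_ : 'I_m) (b : bool) => m%:R^-1 * (if b then p else 1 - p))) /=.
under eq_bigr => s _ do rewrite big_bool /= -mulrDr addrC subrK mulr1.
by rewrite sumr_const card_ord -[_^-1 *+ m]mulr_natr mulVf // pnatr_eq0 -lt0n.
Qed.

(* The number of cycles of length i; fixed points count as cycles. *)
Definition cycle_count (n i : nat) (s : 'S_n) : nat :=
  #|[set C in porbits s | #|C| == i]|.

(* For n > 0; the test says that n is squarefree. *)
Definition moebius (n : nat) : int :=
  if all (fun l => logn l n == 1%N) (primes n) then (-1) ^+ size (primes n) else 0.

(* The exponent i/d - ir of m is a (possibly negative) integer. *)
Definition B_coef (R : realFieldType) (m : nat) (p : R) (i r : nat) : R :=
  \sum_(d <- divisors i)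
     (moebius d)%:~R * m%:R ^ ((i %/ d)%N%:Z - (i * r)%N%:Z)
       * (p ^+ (d * r) - (- (1 - p)) ^+ (d * r)) ^+ (i %/ d).

(* Main.v *)
Require Import Defs.
From mathcomp Require Import all_boot all_order all_algebra all_fingroup.
From mathcomp Require Import cyclic zify.

Set Implicit Arguments.
Unset Strict Implicit.
Unset Printing Implicit Defensive.

Import Order.TTheory GRing.Theory Num.Theory.

Local Open Scope ring_scope.

(** Give each card a letter, its shelf together with the side of the pile on
which it goes. The shuffled deck lists the cards by increasing letter, cards
with the same letter being kept in order (top side) or reversed (bottom side).
The permutation is thus [std w], the inverse of a standardization of the word
[w] of letters, and the problem is about the cycles of [std w] when the letters
of [w] are independent with weights [wt a] of sum 1.

Write s for [std w] and call itinerary of a position x the periodic sequence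
w(s x), w(s^2 x), and so on. Positions are ordered as their itineraries for a
twisted lexicographic order, in which a bottom letter reverses the comparison of
what follows ([itin_twlex]). Hence a word is recovered from the multiset of its
itineraries ([itins_inj]), and sorting shows that every shift-invariant multiset
of n periodic sequences arises ([exists_word]); this is the Gessel-Reutenauer
correspondence in a form where cycles need not be inserted one by one. Adding r
copies of a shift orbit to a multiset multiplies the weight of the word by the
r-th power of the weight of the orbit, and all words have total weight 1. So
a sequence y of period d is the itinerary of at least r positions with
probability [orbit_wt y ^+ r] if r d <= n, and 0 otherwise ([sum_mult_ge]).

Let d divide i. On the k positions with itinerary y, the map s^i is a monotone
bijection: the identity if it is increasing, the reversal, with k mod 2 fixed
points, if it is decreasing ([card_fixed_class]). In both cases the number of
fixed points is the sum of e^(r-1) for 1 <= r <= k, where e = 1 or -1, so its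
expectation follows from the previous paragraph. Grouping the pairs (y, r)
according to l = r d, which requires d to divide g = gcd(i, l), the sum over y
becomes a sum over words of length g of a product over the letters, and
the expected number of fixed points of s^i is the sum over 1 <= l <= n of
     (m^(1 - l/g) (p^(l/g) - (-q)^(l/g)))^g
([expected_fixed], [sum_signed_letter_wt]).

By Moebius inversion that summand is the sum of B_(d, l/d) over the divisors d
of g ([signed_letter_wt_gcd]). On the other hand, the fixed points of s^i are
the points on cycles of length dividing i. The expected number of points on
cycles of length i and the sum of B_(i, r) for r <= n/i therefore have the same
sums over the divisors of every i, and are equal ([expected_cyclesE]). The
generating function says the same, as dividing by 1 - u takes partial sums. *)

(** * Divisor sums and Moebius inversion *)

Lemma moebius_mul_prime q d : prime q -> (0 < d)%N -> ~~ (q %| d)%N ->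
  moebius (q * d) = - moebius d.
Proof.
move=> q_pr d_gt0 qNd; have q_gt0 := prime_gt0 q_pr.
have perm_primes : perm_eq (primes (q * d)) (q :: primes d).
  apply: uniq_perm; rewrite ?primes_uniq //=.
    by rewrite primes_uniq andbT mem_primes q_pr d_gt0.
  by move=> l; rewrite primesM // primes_prime // !inE.
rewrite /moebius (perm_all _ perm_primes) (perm_size perm_primes) /=.
rewrite lognM // lognE q_pr q_gt0 dvdnn divnn q_gt0 logn1.
rewrite lognE q_pr d_gt0 (negPf qNd) /=.
rewrite (@eq_in_all _ _ (fun l => logn l d == 1%N)) => [|l].
  by case: ifP => _; rewrite ?oppr0 // exprS mulN1r.
rewrite mem_primes => /and3P[l_pr _ l_d]; rewrite lognM // (logn_prime l q_pr).
by case: (eqVneq l q) => // ql; rewrite -ql l_d in qNd.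
Qed.

Lemma moebius_sqr_dvd q d : prime q -> (0 < d)%N -> (q ^ 2 %| d)%N ->
  moebius d = 0.
Proof.
move=> q_pr d_gt0; rewrite pfactor_dvdn // => lt1; rewrite /moebius.
case: ifP => // /allP/(_ q); rewrite mem_primes q_pr d_gt0 /=.
rewrite -(expn1 q) pfactor_dvdn // (ltnW lt1) expn1 => /(_ isT).
by case: (logn q d) lt1 => [|[]].
Qed.

(** Multiplication by a prime factor [q] of [n] is a sign-reversing matching
    between the divisors prime to [q] and those divisible exactly once by [q]; the
    divisors that are multiples of [q ^ 2] contribute nothing. *)
Lemma sum_moebius n : (0 < n)%N -> \sum_(d <- divisors n) moebius d = (n == 1%N)%:R.
Proof.
case: n => [//|[_|k _]]; first by rewrite big_seq1.
set n := k.+2; have n_gt0 : (0 < n)%N by [].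
pose q := pdiv n; have q_pr : prime q by apply: pdiv_prime.
have q_gt0 := prime_gt0 q_pr.
rewrite (bigID (dvdn q)) /= (bigID (dvdn (q ^ 2))) /=.
rewrite big1_seq ?add0r => [|d /andP[/andP[_ q2d]]]; last first.
  by rewrite -dvdn_divisors // => /dvdn_gt0 d_gt0; apply: (moebius_sqr_dvd q_pr); rewrite ?d_gt0.
rewrite -big_filter -[X in _ + X]big_filter.
rewrite (perm_big [seq (q * d)%N | d <- divisors n & ~~ (q %| d)%N]) /=.
  rewrite big_map big_seq_cond [X in X + _](eq_bigr (fun d => - moebius d)).
    by rewrite -big_seq_cond sumrN addNr.
  move=> d; rewrite andbT mem_filter -dvdn_divisors // => /andP[qNd d_n].
  by rewrite moebius_mul_prime // (dvdn_gt0 n_gt0).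
apply: uniq_perm; first by rewrite filter_uniq ?divisors_uniq.
  rewrite map_inj_uniq ?filter_uniq ?divisors_uniq // => a b /eqP.
  by rewrite eqn_pmul2l // => /eqP.
move=> d; rewrite mem_filter -dvdn_divisors //; apply/idP/mapP.
  case/andP=> /andP[/dvdnP[e ->]]; rewrite [(e * q)%N]mulnC -[(q ^ 2)%N]/(q * q)%N.
  rewrite dvdn_pmul2l // => qNe d_n; exists e => //.
  by rewrite mem_filter qNe -dvdn_divisors // (dvdn_trans _ d_n) // dvdn_mull.
case=> e; rewrite mem_filter -dvdn_divisors // => /andP[qNe e_n] ->.
rewrite dvdn_mulr // -[(q ^ 2)%N]/(q * q)%N dvdn_pmul2l // qNe /=.
by rewrite Gauss_dvd ?e_n ?pdiv_dvd // prime_coprime.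
Qed.

Section Divisors.
Variable R : nzRingType.

(** Moebius inversion, in the direction where the summatory function is known *)
Lemma sum_divisors_moebius (G : nat -> R) n : (0 < n)%N ->
  \sum_(d <- divisors n) \sum_(e <- divisors d) (moebius e)%:~R * G (d %/ e)%N = G n.
Proof.
move=> n_gt0.
(* Sum over the pairs (e, f) with e f dividing n, f first. *)
transitivity (\sum_(f <- divisors n) \sum_(e <- divisors (n %/ f)) (moebius e)%:~R * G f).
  transitivity (\sum_(d <- divisors n) \sum_(f <- divisors d) (moebius (d %/ f))%:~R * G f).
    apply: eq_big_seq => d; rewrite -dvdn_divisors // => /(dvdn_gt0 n_gt0) d_gt0.
    rewrite (perm_big [seq (d %/ f)%N | f <- divisors d]) /=.
      rewrite big_map; apply: eq_big_seq => f; rewrite -dvdn_divisors // => f_d.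
      by rewrite divnA // mulKn.
    have invol f : (f %| d)%N -> (d %/ (d %/ f))%N = f by move=> f_d; rewrite divnA // mulKn.
    apply: uniq_perm; rewrite ?divisors_uniq //.
      rewrite map_inj_in_uniq ?divisors_uniq // => a b.
      by rewrite -!dvdn_divisors // => /invol a_d /invol b_d ab; rewrite -a_d ab b_d.
    move=> f; rewrite -dvdn_divisors //; apply/idP/mapP => [f_d|[g]].
      by exists (d %/ f)%N; rewrite ?invol // -dvdn_divisors // dvdn_div.
    by rewrite -dvdn_divisors // => g_d ->; rewrite dvdn_div.
  pose F d f := (moebius (d %/ f))%:~R * G f : R.
  transitivity (\sum_(d <- divisors n) \sum_(f <- divisors n | (f %| d)%N) F d f).
    apply: eq_big_seq => d; rewrite -dvdn_divisors // => d_n.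
    have d_gt0 := dvdn_gt0 n_gt0 d_n.
    rewrite -[RHS]big_filter; apply: perm_big; apply: uniq_perm; rewrite ?filter_uniq ?divisors_uniq //.
    move=> f; rewrite mem_filter -!dvdn_divisors //.
    by apply/idP/andP => [f_d|[]//]; rewrite f_d (dvdn_trans f_d).
  rewrite (exchange_big_dep xpredT) //=; apply: eq_big_seq => f; rewrite -dvdn_divisors // => f_n.
  have f_gt0 := dvdn_gt0 n_gt0 f_n.
  rewrite -big_filter (perm_big [seq (f * e)%N | e <- divisors (n %/ f)]) /=.
    by rewrite big_map; apply: eq_bigr => e _; rewrite /F mulKn.
  have nf_gt0 : (0 < n %/ f)%N by rewrite divn_gt0 // dvdn_leq.
  apply: uniq_perm; rewrite ?filter_uniq ?divisors_uniq //.
    by rewrite map_inj_uniq ?divisors_uniq // => a b /eqP; rewrite eqn_pmul2l // => /eqP.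
  move=> d; rewrite mem_filter -dvdn_divisors //; apply/andP/mapP => [[/dvdnP[e ->] ef_n]|[e]].
    by exists e; rewrite 1?mulnC // -dvdn_divisors // dvdn_divRL // mulnC.
  by rewrite -dvdn_divisors // dvdn_divRL // => ef_n ->; rewrite dvdn_mulr // mulnC.
transitivity (\sum_(f <- divisors n) (n %/ f == 1)%N%:R * G f).
  apply: eq_big_seq => f; rewrite -dvdn_divisors // => f_n.
  have nf_gt0 : (0 < n %/ f)%N by rewrite divn_gt0 ?(dvdn_gt0 n_gt0 f_n) // dvdn_leq.
  by rewrite -mulr_suml -rmorph_sum /= sum_moebius //; case: eqP => _; rewrite ?mulr1z ?mulr0z.
rewrite (bigD1_seq n) ?divisors_uniq ?divisors_id //= divnn n_gt0 eqxx mul1r.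
rewrite big_seq_cond big1 ?addr0 // => f; rewrite -dvdn_divisors // => /andP[f_n fNn].
case: eqP => [E|]; last by rewrite mul0r.
by case/eqP: fNn; rewrite -(divnK f_n) E mul1n.
Qed.

Lemma divisor_sums_inj (a b : nat -> R) :
    (forall n, (0 < n)%N -> \sum_(d <- divisors n) a d = \sum_(d <- divisors n) b d) ->
  forall n, (0 < n)%N -> a n = b n.
Proof.
move=> eq_sums n; elim/ltn_ind: n => n IHn n_gt0.
have := eq_sums n n_gt0; rewrite !(bigD1_seq n) ?divisors_uniq ?divisors_id //=.
rewrite [in LHS]big_seq_cond [in RHS]big_seq_cond (eq_bigr b) => [/addIr//|d].
rewrite -dvdn_divisors // => /andP[d_n dNn]; apply: IHn (dvdn_gt0 n_gt0 d_n).
by rewrite ltn_neqAle dNn dvdn_leq.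
Qed.

Lemma sum_multiples (phi : nat -> R) d n : (0 < d)%N ->
  \sum_(1 <= l < n.+1 | (d %| l)%N) phi (l %/ d)%N = \sum_(1 <= r < (n %/ d).+1) phi r.
Proof.
move=> d_gt0; rewrite -big_filter (perm_big [seq (r * d)%N | r <- index_iota 1 (n %/ d).+1]) /=.
  by rewrite big_map; apply: eq_bigr => r _; rewrite mulnK.
apply: uniq_perm; rewrite ?filter_uniq ?iota_uniq //.
  by rewrite map_inj_uniq ?iota_uniq // => a b /eqP; rewrite eqn_pmul2r // => /eqP.
move=> l; rewrite mem_filter mem_index_iota; apply/andP/mapP.
  case=> /dvdnP[r ->]; rewrite ltnS muln_gt0 -leq_divRL // => /andP[/andP[r_gt0 _] le_r].
  by exists r => //; rewrite mem_index_iota r_gt0.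
case=> r; rewrite mem_index_iota ltnS => /andP[r_gt0 le_r] ->.
by rewrite dvdn_mull // muln_gt0 r_gt0 d_gt0 ltnS -leq_divRL.
Qed.

End Divisors.

(** * Periods under iteration *)

Lemma iter_mul_fixed (T : Type) (f : T -> T) k x q :
  iter k f x = x -> iter (q * k) f x = x.
Proof. by move=> fx; elim: q => // q IHq; rewrite mulSn iterD IHq. Qed.

Section Iterates.
Variables (T : finType) (f : T -> T) (f_inj : injective f).

Lemma iter_eq_order i x : (iter i f x == x) = (fingraph.order f x %| i)%N.
Proof.
rewrite {1}(divn_eq i (fingraph.order f x)) addnC iterD iter_mul_fixed ?iter_order //.
rewrite /dvdn.
have lt_r : (i %% fingraph.order f x < fingraph.order f x)%N by rewrite ltn_mod fingraph.order_gt0.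
apply/eqP/eqP => [/(congr1 (findex f x))|-> //].
by rewrite findex_iter // findex0.
Qed.

Lemma prod_iter_period (R : comNzRingType) (phi : T -> R) x g : (fingraph.order f x %| g)%N ->
  \prod_(t < g) phi (iter t f x) = (\prod_(y <- fingraph.orbit f x) phi y) ^+ (g %/ fingraph.order f x).
Proof.
case/dvdnP=> k ->; rewrite mulnK ?fingraph.order_gt0 //.
rewrite -(big_mkord xpredT (fun t => phi (iter t f x))).
elim: k => [|k IHk]; first by rewrite big_geq.
have iter_mul := iter_mul_fixed k (iter_order f_inj x).
rewrite mulSn addnC (big_cat_nat (n := (k * fingraph.order f x)%N)) ?leq_addr //= IHk exprSr.
congr (_ * _); rewrite -{1}[(k * _)%N]add0n big_addn addKn /fingraph.orbit.
under eq_bigr => t _ do rewrite iterD iter_mul.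
have -> : traject f x (fingraph.order f x) = [seq iter t f x | t <- iota 0 (fingraph.order f x)].
  apply: (@eq_from_nth _ x) => [|t]; rewrite size_traject ?size_map ?size_iota // => lt_t.
  by rewrite nth_traject // (nth_map 0%N) ?size_iota // nth_iota.
by rewrite big_map /index_iota subn0.
Qed.

End Iterates.

(** * Fixed points of monotone bijections *)

Section MonotoneBijections.
Variables (n : nat) (e : seq 'I_n) (t : 'I_n -> 'I_n).
Hypotheses (e_incr : pairwise (fun x y : 'I_n => x < y)%N e)
  (t_perm : perm_eq (map t e) e).

(** A list sorted for a strict order is determined by its elements, so [map t e],
    sorted like [e] and with the same elements, is [e]. *)
Lemma increasing_fixed :
  {in e &, forall x y : 'I_n, (x < y)%N -> (t x < t y)%N} -> {in e, t =1 id}.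
Proof.
move=> t_incr; suff /eq_in_map : map t e = map id e by [].
rewrite map_id; apply: (@pairwise_eq _ (fun x y : 'I_n => x < y)%N _) => //; first by move=> x y; lia.
rewrite pairwise_map; apply: sub_in_pairwise e_incr; first exact: t_incr.
exact/allP.
Qed.

Lemma count_middle k : count (fun j => k - j.+1 == j)%N (iota 0 k) = odd k.
Proof.
have -> : count (fun j => k - j.+1 == j)%N (iota 0 k) =
          count (fun j => (j == k./2) && odd k) (iota 0 k).
  by apply: eq_in_count => j; rewrite mem_iota; lia.
case: (boolP (odd k)) => odd_k.
  under eq_count => j do rewrite andbT.
  by rewrite count_uniq_mem ?iota_uniq // mem_iota; lia.
by under eq_count => j do rewrite andbF; rewrite count_pred0.
Qed.

(** Here [map t e] is the reverse of [e], so only the middle element, which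
    exists when [size e] is odd, is fixed. *)
Lemma decreasing_count_fixed :
    {in e &, forall x y : 'I_n, (x < y)%N -> (t y < t x)%N} ->
  count (fun x => t x == x) e = odd (size e).
Proof.
move=> t_decr.
have e_uniq : uniq e by apply: pairwise_uniq e_incr => x; rewrite ltnn.
have t_rev : map t e = rev e.
  apply: (@pairwise_eq _ (fun x y : 'I_n => y < x)%N _); first by move=> x y; lia.
  - by rewrite pairwise_map; apply: (sub_in_pairwise t_decr) e_incr; apply/allP.
  - elim: (e) e_incr => //= x s IHs /andP[/allP x_s /IHs s_rev].
    rewrite rev_cons pairwise_rcons s_rev andbT.
    by apply/allP => y; rewrite mem_rev => /x_s.
  - by rewrite (perm_trans t_perm) // perm_sym perm_rev.
case: e e_uniq t_rev => [//|x0 s0]; set s := x0 :: s0 => s_uniq t_rev.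
rewrite -count_middle -[in LHS](mkseq_nth x0 s) count_map.
apply: eq_in_count => j; rewrite mem_iota add0n /= => lt_j.
by rewrite -(nth_map x0 x0) // t_rev nth_rev // nth_uniq ?ltn_subrL.
Qed.

End MonotoneBijections.

(** * The twisted lexicographic order *)

Section SignedAlphabet.

(** Letters are ordered by [code]; the letters with [up a = false] reverse the
    order. *)
Variables (A : finType) (code : A -> nat) (up : A -> bool).
Hypothesis code_inj : injective code.

(** The flag [b] tells whether the comparison is currently direct or reversed.
    Only sequences of equal sizes are meant to be compared. *)
Fixpoint twlex (b : bool) (s t : seq A) : bool :=
  match s, t with
  | x :: s', y :: t' =>
      (if b then code x < code y else code y < code x)%N
        || (x == y) && twlex (b == up x) s' t'
  | _, _ => true
  end.

Lemma twlexN b s t : twlex (~~ b) s t = twlex b t s.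
Proof.
elim: s t b => [|x s IHs] [|y t] b //=.
have -> : (~~ b == up x) = ~~ (b == up x) by case: b (up x) => [] [].
rewrite IHs eq_sym; case: (eqVneq y x) => [->|_]; rewrite ?orbF; by case: b.
Qed.

Lemma twlex_total b s t : twlex b s t || twlex b t s.
Proof.
elim: s t b => [|x s IHs] [|y t] b //=.
rewrite [y == x]eq_sym; case: (eqVneq x y) => [<-|xNy] /=.
  by rewrite -!orbA [X in _ || X]orbCA orbA IHs orbT.
have : code x != code y by apply: contraNneq xNy => /code_inj->.
by case: b; rewrite !orbF neq_ltn // orbC.
Qed.

Lemma twlex_anti b s t : size s = size t -> twlex b s t -> twlex b t s -> s = t.
Proof.
elim: s t b => [|x s IHs] [|y t] b //= [sz].
have E : code x = code y -> x = y by apply: code_inj.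
rewrite [y == x]eq_sym; case: (eqVneq x y) => [<-|_] /=.
  by case: b; rewrite ltnn /= => st ts; rewrite (IHs _ _ sz st ts).
by case: b; rewrite !orbF => xy yx; lia.
Qed.

Lemma twlex_trans b s t u : size s = size t -> size t = size u ->
  twlex b s t -> twlex b t u -> twlex b s u.
Proof.
elim: s t u b => [|x s IHs] [|y t] [|z u] b //= [st] [tu].
case/orP=> [xy|/andP[/eqP<- lt_st]] /orP[yz|/andP[/eqP<- lt_tu]].
- by apply/orP; left; case: b xy yz; lia.
- by rewrite xy.
- by rewrite yz.
- by rewrite eqxx (IHs t) ?orbT.
Qed.

(** Rotating a periodic sequence moves its last letter to the front: by this lemma,
    that letter can be dropped from its old place before it is compared first. *)
Lemma twlex_rcons b s t a : size s = size t ->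
  twlex b (rcons s a) (rcons t a) = twlex b s t.
Proof.
elim: s t b => [|x s IHs] [|y t] b //= => [_|[sz]]; first by rewrite eqxx orbT.
by rewrite IHs.
Qed.

(** * Standardization of a word *)

Section Standardization.

Variable n : nat.
Implicit Types (w : {ffun 'I_n -> A}) (s : 'S_n).

Definition letter_le w (c d : 'I_n) :=
  (code (w c) < code (w d))%N || (w c == w d) && (if up (w c) then c <= d else d <= c)%N.

Lemma letter_le_total w : total (letter_le w).
Proof.
move=> c d; rewrite /letter_le; case: (eqVneq (w c) (w d)) => [->|/eqP wNw] /=.
  by rewrite ltnn /=; case: up; lia.
have : code (w c) <> code (w d) by move/code_inj.
by rewrite !orbF; lia.
Qed.

Lemma letter_le_trans w : transitive (letter_le w).
Proof.
move=> d c e; rewrite /letter_le.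
case/orP=> [cd|/andP[/eqP-> cd]] /orP[de|/andP[/eqP ed de]].
- by rewrite (ltn_trans cd de).
- by rewrite -ed cd.
- by rewrite de.
by rewrite -ed eqxx /= ltnn /=; case: up cd de; lia.
Qed.

Lemma letter_le_anti w : antisymmetric (letter_le w).
Proof.
move=> c d; rewrite /letter_le => /andP[].
case/orP=> [cd|/andP[/eqP-> cd]] /orP[dc|/andP[/eqP ed dc]].
- lia.
- by rewrite ed ltnn in cd.
- by rewrite ltnn in dc.
by apply: val_inj => /=; case: up cd dc; lia.
Qed.

Definition std_seq w := sort (letter_le w) (enum 'I_n).

Lemma perm_std_seq w : perm_eq (std_seq w) (enum 'I_n).
Proof. by rewrite perm_sort. Qed.

Lemma size_std_seq w : size (std_seq w) = n.
Proof. by rewrite (perm_size (perm_std_seq w)) size_enum_ord. Qed.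

Definition std_fun w (j : 'I_n) := nth j (std_seq w) j.

Lemma std_fun_inj w : injective (std_fun w).
Proof.
move=> j k; rewrite /std_fun (set_nth_default k) ?size_std_seq // => /eqP.
rewrite nth_uniq ?size_std_seq // => [/eqP/val_inj //|].
by rewrite (perm_uniq (perm_std_seq w)) enum_uniq.
Qed.

(** This is the inverse of the standardization of [w] in the usual sense: it sends
    a position of the sorted list to the place it comes from in [w]. *)
Definition std w : 'S_n := perm (@std_fun_inj w).

Lemma map_std w : [seq std w j | j <- enum 'I_n] = std_seq w.
Proof.
have [n0|n_gt0] := posnP n.
  have -> : std_seq w = [::] by apply: size0nil; rewrite size_std_seq.
  by apply: size0nil; rewrite size_map size_enum_ord.
pose x0 := Ordinal n_gt0.
apply: (@eq_from_nth _ x0) => [|k]; rewrite size_map size_enum_ord ?size_std_seq // => lt_k.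
rewrite (nth_map x0) ?size_enum_ord // permE /std_fun nth_enum_ord //.
by apply: set_nth_default; rewrite size_std_seq.
Qed.

Lemma pairwise_enum_ord k : pairwise (fun x y : 'I_k => x < y)%N (enum 'I_k).
Proof.
have := iota_ltn_sorted 0 k.
by rewrite sorted_pairwise -?val_enum_ord ?pairwise_map //; apply: ltn_trans.
Qed.

Lemma stdP w (x y : 'I_n) : (x < y)%N ->
  (code (w (std w x)) < code (w (std w y)))%N \/
  w (std w x) = w (std w y) /\
    (if up (w (std w x)) then std w x < std w y else std w y < std w x)%N.
Proof.
move=> lt_xy; have : letter_le w (std w x) (std w y).
  have lt_y := ltn_ord y.
  have := letter_le_total w; have := @letter_le_trans w.
  move=> tr tot; have := sort_sorted tot (enum 'I_n).
  rewrite sorted_pairwise // -/(std_seq w) -map_std => /(pairwiseP (std w x)).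
  move=> /(_ x y); rewrite !inE size_map size_enum_ord => /(_ (ltn_ord x) (ltn_ord y) lt_xy).
  by rewrite !(nth_map x (std w x) (std w)) ?size_enum_ord // !nth_ord_enum.
have : (std w x : nat) <> std w y.
  by move/val_inj/perm_inj => E; rewrite E ltnn in lt_xy.
rewrite /letter_le => ne /orP[|/andP[/eqP E]]; [by left|right; split=> //].
by move: b; case: up; lia.
Qed.

End Standardization.

(** * Itineraries *)

Section Itineraries.

(** Periodic sequences are truncated to [N] terms, [N] being a multiple of all the
    periods that occur, so that they form a finite type. *)
Variables (N : nat) (a0 : A).
Hypothesis N_gt0 : (0 < N)%N.

Definition shift (y : N.-tuple A) : N.-tuple A := [tuple of rot 1 y].

Lemma shift_inj : injective shift.
Proof. by move=> y z /(congr1 val) /= /rot_inj/val_inj. Qed.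

Lemma iter_shift t y : (t <= N)%N -> iter t shift y = rot t y :> seq A.
Proof.
elim: t => [|t IHt] le_t; first by rewrite rot0.
by rewrite iterS /= IHt ?(ltnW le_t) // -rotS // size_tuple.
Qed.

Lemma last_iter_shift t y : (t < N)%N -> last a0 (iter t.+1 shift y) = nth a0 y t.
Proof.
move=> lt_t; rewrite iter_shift // /rot last_cat.
by rewrite (take_nth a0) ?size_tuple // last_rcons.
Qed.

Lemma head_iter_shift t y : head a0 (iter t shift y) = nth a0 y (t %% N).
Proof.
have per : iter N shift y = y by apply: val_inj; rewrite /= iter_shift // -{1}(size_tuple y) rot_size.
have lt_r : (t %% N < N)%N by rewrite ltn_mod.
rewrite {1}(divn_eq t N) addnC iterD iter_mul_fixed // iter_shift 1?ltnW //.
by rewrite /rot (drop_nth a0) // size_tuple.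
Qed.

Lemma map_last_shift y :
  [seq last a0 (tval z) | z <- traject shift (shift y) N] = y.
Proof.
apply: (@eq_from_nth _ a0); rewrite size_map size_traject ?size_tuple // => t lt_t.
by rewrite (nth_map (shift y)) ?size_traject // nth_traject // -iterSr last_iter_shift.
Qed.

Section Words.

Variable n : nat.
Implicit Types w : {ffun 'I_n -> A}.

Lemma size_itin w x : size [seq w z | z <- traject (std w) (std w x) N] == N.
Proof. by rewrite size_map size_traject. Qed.

(** The itinerary starts with the letter of [std w x] and ends with that of [x]:
    in this way the first letters of the itineraries are sorted. *)
Definition itin w x : N.-tuple A := Tuple (size_itin w x).

Definition itins w := [seq itin w x | x <- enum 'I_n].

Definition mult w y := count_mem y (itins w).

Lemma size_itins w : size (itins w) = n.
Proof. by rewrite size_map size_enum_ord. Qed.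

Lemma nth_itins w y0 (x : 'I_n) : nth y0 (itins w) x = itin w x.
Proof. by rewrite (nth_map x) ?size_enum_ord // nth_ord_enum. Qed.

Lemma multE w y : mult w y = #|[pred x | itin w x == y]|.
Proof.
rewrite /mult count_map cardE -(size_filter _ (enum 'I_n)); congr size.
by rewrite [in LHS]enumT.
Qed.

Lemma sum_mult w : (\sum_y mult w y)%N = n.
Proof.
rewrite -[RHS](card_ord n) -sum1_card (partition_big (itin w) xpredT) //=.
by apply: eq_bigr => y _; rewrite multE sum1_card.
Qed.

(** By [stdP], either the next letters of [x] and [y] decide, or they are equal and
    the images of [x] and [y] are in the order prescribed by that letter. *)
Lemma itin_twlex w (x y : 'I_n) : (x < y)%N -> twlex true (itin w x) (itin w y).
Proof.
suff twlex_traject k b (u v : 'I_n) : (if b then u < v else v < u)%N ->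
    twlex b (map w (traject (std w) (std w u) k)) (map w (traject (std w) (std w v) k)).
  exact: (twlex_traject N true).
elim: k b u v => //= k IHk b u v.
case: b => lt_uv; have [->//|[-> lt_suv]] := stdP w lt_uv.
  by rewrite ltnn eqxx /=; apply: IHk; case: (up _) lt_suv.
by rewrite ltnn eqxx /=; apply: IHk; case: (up _) lt_suv.
Qed.

Lemma itins_sorted w : pairwise (twlex true) [seq tval y | y <- itins w].
Proof.
rewrite /itins -map_comp pairwise_map; move: (pairwise_enum_ord n).
by apply: sub_pairwise => x y; apply: itin_twlex.
Qed.

Hypothesis n_N : (n`! %| N)%N.

Lemma iter_std_N w x : iter N (std w) x = x.
Proof.
rewrite -permX; suff -> : (std w ^+ N = 1)%g by rewrite perm1.
apply/eqP; rewrite -order_dvdn (dvdn_trans _ n_N) //.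
have := @order_dvdG _ [group of [set: 'S_n]] (std w) (in_setT _).
by rewrite /= cardsT card_Sn.
Qed.

Lemma itin_std w x : itin w (std w x) = shift (itin w x).
Proof.
apply: val_inj => /=; rewrite -map_rot; congr map.
have := iter_std_N w (std w x); case: (N) N_gt0 => // k _ per.
by rewrite trajectSr -iterSr per /= rot1_cons.
Qed.

Lemma itin_iter w i x : itin w (iter i (std w) x) = iter i shift (itin w x).
Proof. by elim: i => //= i IHi; rewrite itin_std IHi. Qed.

Lemma last_itin w x : last a0 (itin w x) = w x.
Proof.
rewrite /= -{2}(iter_std_N w x); case: (N) N_gt0 => // k _.
by rewrite iterSr /= last_map last_traject.
Qed.

Lemma head_itin w x : head a0 (itin w x) = w (std w x).
Proof. by rewrite /=; case: (N) N_gt0. Qed.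

Lemma mult_shift w y : mult w (shift y) = mult w y.
Proof.
rewrite !multE -(card_imset [pred x | itin w x == y] (@perm_inj _ (std w))).
apply: eq_card => x; rewrite inE; apply/idP/imsetP => [/eqP Ex|[z]].
  exists ((std w)^-1%g x); rewrite ?permKV // inE.
  by rewrite -(inj_eq shift_inj) -itin_std permKV Ex.
by rewrite inE => /eqP <- ->; rewrite itin_std.
Qed.

(** A word is read off from the last letters of its itineraries, and these are
    listed in increasing order. *)
Lemma itins_inj w w' : mult w =1 mult w' -> w = w'.
Proof.
move=> eq_mult; suff E : itins w = itins w'.
  by apply/ffunP => x; rewrite -last_itin -(nth_itins w (itin w x)) E nth_itins last_itin.
apply: (inj_map val_inj); apply: (@pairwise_eq _ (fun s t => (size s == size t) && twlex true s t)).
- by move=> s t /andP[/andP[/eqP sz st] /andP[_ ts]]; apply: twlex_anti ts.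
- rewrite pairwise_map; move: (itins_sorted w); rewrite pairwise_map.
  by apply: sub_pairwise => y z /=; rewrite !size_tuple eqxx.
- rewrite pairwise_map; move: (itins_sorted w'); rewrite pairwise_map.
  by apply: sub_pairwise => y z /=; rewrite !size_tuple eqxx.
apply: perm_map; apply/allP => y _; exact/eqP/eq_mult.
Qed.

(** The inverse construction, for a sorted list [L] of itineraries *)
Definition word_of (L : seq (N.-tuple A)) : {ffun 'I_n -> A} :=
  [ffun j : 'I_n => last a0 (nth [::] [seq tval y | y <- L] j)].

(** The list of the [L_(std w j)], rotated backwards, is sorted: first by the letter
    [w (std w j)] moved to the front, then because [L] is sorted and [std w]
    respects or reverses the order of the cards with that letter. As it has the
    same elements as [L], it equals [L]: the shift sends [L_j] to [L_(std w j)],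
    which makes [L_j] the itinerary of [j]. *)
Lemma itins_word_of L : size L = n -> pairwise (twlex true) [seq tval y | y <- L] ->
  perm_eq (map shift L) L -> itins (word_of L) = L.
Proof.
move=> szL L_sorted L_shift; set w := word_of L.
have [n0|n_gt0] := posnP n.
  by rewrite [L]size0nil ?szL // [LHS]size0nil // size_itins.
pose y0 := nth (nseq_tuple N a0) L 0; pose l (j : 'I_n) := nth y0 L j.
have w_last j : w j = last a0 (l j).
  by rewrite ffunE (nth_map y0) // szL.
have L_map : map l (enum 'I_n) = L.
  apply: (@eq_from_nth _ y0); rewrite size_map size_enum_ord // => k lt_k.
  by rewrite (nth_map (Ordinal n_gt0)) ?size_enum_ord // /l nth_enum_ord.
pose unshift (y : N.-tuple A) : N.-tuple A := [tuple of rotr 1 y].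
have unshiftK : cancel unshift shift by move=> y; apply: val_inj; rewrite /= rotrK.
have shiftK : cancel shift unshift by move=> y; apply: val_inj; rewrite /= rotK.
have unshift_cons y : unshift y = last a0 y :: belast (head a0 y) (behead y) :> seq A.
  rewrite /=; case: y => -[|x s] sz /=; first by exfalso; move: N_gt0; rewrite -(eqP sz).
  by rewrite lastI rotr1_rcons.
have l_std : [seq unshift (l (std w j)) | j <- enum 'I_n] = L.
  apply: (inj_map val_inj).
  (* The size condition is what makes the twisted order antisymmetric. *)
  apply: (@pairwise_eq _ (fun s t => (size s == size t) && twlex true s t)).
  - by move=> s t /andP[/andP[/eqP sz st] /andP[_ ts]]; apply: twlex_anti ts.
  - rewrite -map_comp pairwise_map; move: (pairwise_enum_ord n); apply: sub_pairwise => x y lt_xy.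
    apply/andP; split; first by rewrite /= !size_rotr !size_tuple.
    change (twlex true (unshift (l (std w x))) (unshift (l (std w y)))).
    rewrite !unshift_cons /= -!w_last; have [->//|[Ew lt_s]] := stdP w lt_xy.
    rewrite Ew eqxx ltnn /=.
    have l_le (u v : 'I_n) : (u < v)%N -> twlex true (l u) (l v).
      move=> lt_uv; move/(pairwiseP [::]): L_sorted => /(_ u v).
      rewrite !inE size_map szL => /(_ (ltn_ord u) (ltn_ord v) lt_uv).
      by rewrite !(nth_map y0) ?szL.
    have split_last (z : N.-tuple A) : z = rcons (belast (head a0 z) (behead z)) (last a0 z) :> seq A.
      case: z => -[|a s] sz /=; first by exfalso; move: N_gt0; rewrite -(eqP sz).
      by rewrite -lastI.
    have szb (z : N.-tuple A) : size (belast (head a0 z) (behead z)) = N.-1.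
      by rewrite size_belast size_behead size_tuple.
    have l_le_belast (u v : 'I_n) : w u = w v -> (u < v)%N ->
        twlex true (belast (head a0 (l u)) (behead (l u))) (belast (head a0 (l v)) (behead (l v))).
      move=> Euv /l_le lt_uv; rewrite -(twlex_rcons _ (w u)) ?szb //.
      by rewrite [in X in twlex _ _ X]Euv !w_last -!split_last.
    move: lt_s; rewrite Ew; case: (up _) => lt_s; first exact: l_le_belast.
    by rewrite -[false]/(~~ true) twlexN; apply: l_le_belast.
  - rewrite pairwise_map; move: L_sorted; rewrite pairwise_map.
    by apply: sub_pairwise => y z /=; rewrite !size_tuple eqxx.
  apply: perm_map.
  have -> : [seq unshift (l (std w j)) | j <- enum 'I_n] = map unshift (map l (map (std w) (enum 'I_n))).
    by rewrite -!map_comp.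
  apply: (@perm_trans _ (map unshift L)).
    rewrite -[X in perm_eq _ (map _ X)]L_map; do 2!apply: perm_map.
    by rewrite map_std perm_std_seq.
  apply: (@perm_trans _ (map unshift (map shift L))).
    by apply: perm_map; rewrite perm_sym.
  by rewrite -map_comp (eq_map (g := id)) ?map_id.
have l_shift j : l (std w j) = shift (l j).
  rewrite -[LHS]unshiftK; congr shift; rewrite /l -[in RHS]l_std.
  by rewrite (nth_map j) ?size_enum_ord // nth_ord_enum.
rewrite -[RHS]L_map; apply: eq_map => x; apply: val_inj => /=.
rewrite -[RHS](map_last_shift (l x)).
rewrite (eq_map (g := (fun y => last a0 (tval y)) \o l)) => [|z]; last exact: w_last.
rewrite map_comp; congr map; rewrite -l_shift.
have l_traject k z : map l (traject (std w) z k) = traject shift (l z) k.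
  by elim: k z => //= k IHk z; rewrite IHk l_shift.
exact: l_traject.
Qed.

(** It suffices to sort the multiset. *)
Lemma exists_word (K : N.-tuple A -> nat) : (\sum_y K y)%N = n ->
  (forall y, K (shift y) = K y) -> exists w, mult w =1 K.
Proof.
move=> sumK K_shift.
pose le (y z : N.-tuple A) := twlex true y z.
pose L := sort le (flatten [seq nseq (K y) y | y <- enum {: N.-tuple A}]).
have count_L y : count_mem y L = K y.
  rewrite count_sort count_flatten -map_comp sumnE big_map big_enum /=.
  rewrite (bigD1 y) //= count_nseq /= eqxx mul1n big1 ?addn0 // => z /negPf zNy.
  by rewrite count_nseq /= zNy mul0n.
have szL : size L = n.
  rewrite size_sort size_flatten /shape -map_comp sumnE big_map big_enum /= -sumK.
  by apply: eq_bigr => y _; rewrite size_nseq.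
exists (word_of L) => y; rewrite -count_L /mult itins_word_of //.
  rewrite pairwise_map -(@sorted_pairwise _ le); first by apply: sort_sorted => u v; apply: twlex_total.
  by move=> v u z; apply: twlex_trans; rewrite !size_tuple.
apply/allP => z _ /=; rewrite eq_sym.
have [u ->] : exists u, z = shift u.
  by exists (invF shift_inj z); rewrite f_invF.
rewrite count_L K_shift -count_L count_map; apply/eqP.
by apply: eq_count => v /=; rewrite (inj_eq shift_inj).
Qed.

End Words.

(** * Words in which a given itinerary occurs often *)

(** A choice of the word given by [exists_word] *)
Definition word_with n (K : N.-tuple A -> nat) : {ffun 'I_n -> A} :=
  odflt [ffun=> a0] [pick w : {ffun 'I_n -> A} | [forall y, mult w y == K y]].

Lemma mult_word_with n K : (n`! %| N)%N -> (\sum_y K y)%N = n ->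
  (forall y, K (shift y) = K y) -> mult (word_with n K) =1 K.
Proof.
move=> n_N sumK K_shift; rewrite /word_with; case: pickP => [w /forallP w_K y|no_w].
  exact/eqP.
have [w w_K] := exists_word sumK K_shift.
by have /forallP[] := negbT (no_w w); move=> y; rewrite w_K.
Qed.

Lemma word_with_mult n (w : {ffun 'I_n -> A}) K : (n`! %| N)%N ->
  mult w =1 K -> word_with n K = w.
Proof.
move=> n_N w_K; apply: (itins_inj n_N) => y; rewrite w_K mult_word_with //.
  by rewrite -(eq_bigr _ (fun y _ => w_K y)) sum_mult.
by move=> z; rewrite -!w_K mult_shift.
Qed.

Notation period := (fingraph.order shift).
Notation orbit := (fingraph.orbit shift).

Lemma mem_orbit_shift y z : (shift z \in orbit y) = (z \in orbit y).
Proof.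
rewrite -!fconnect_orbit; apply/idP/idP => [yz|/connect_trans-> //].
  by rewrite (connect_trans yz) // fconnect_sym ?fconnect1 //; apply: shift_inj.
exact: fconnect1.
Qed.

Lemma mult_orbit n (w : {ffun 'I_n -> A}) y z : (n`! %| N)%N ->
  z \in orbit y -> mult w z = mult w y.
Proof.
move=> n_N /trajectP[t _ ->]; elim: t => //= t <-.
exact: mult_shift.
Qed.

Section Weights.

Variables (R : comNzRingType) (wt : A -> R).

Definition word_wt n (w : {ffun 'I_n -> A}) := \prod_x wt (w x).

Definition orbit_wt (y : N.-tuple A) := \prod_(z <- orbit y) wt (head a0 z).

Lemma word_wtE n (w : {ffun 'I_n -> A}) : (n`! %| N)%N ->
  word_wt w = \prod_(y : N.-tuple A) wt (head a0 y) ^+ mult w y.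
Proof.
move=> n_N; rewrite /word_wt (reindex_inj (@perm_inj _ (std w))) /=.
rewrite (partition_big (itin w) xpredT) //=; apply: eq_bigr => y _.
rewrite multE -prodr_const; apply: eq_big => [x|x /eqP <-]; first by rewrite inE.
by rewrite head_itin.
Qed.

Lemma prod_orbit y r :
  \prod_(z in orbit y) wt (head a0 z) ^+ r = orbit_wt y ^+ r.
Proof.
by rewrite -prodrXl big_uniq ?orbit_uniq.
Qed.

Lemma sum_word_wt n : \sum_a wt a = 1 -> \sum_(w : {ffun 'I_n -> A}) word_wt w = 1.
Proof.
by move=> wt1; rewrite -(bigA_distr_bigA (fun _ => wt)) big1.
Qed.

(** Removing [r] copies of the whole orbit of [y] from the multiset of itineraries
    is a bijection from the words in which [y] occurs at least [r] times to all
    the words of length [n - r * period y], whose total weight is 1. *)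
Lemma sum_mult_ge n y r : (n`! %| N)%N -> \sum_a wt a = 1 ->
  \sum_(w : {ffun 'I_n -> A} | (r <= mult w y)%N) word_wt w =
    if (r * period y <= n)%N then orbit_wt y ^+ r else 0.
Proof.
move=> n_N wt1.
have card_orbit : (\sum_z (z \in orbit y))%N = period y.
  rewrite -size_orbit -(card_uniqP (orbit_uniq shift y)) -sum1_card [RHS]big_mkcond /=.
  by apply: eq_bigr => z _; case: (z \in _).
case: leqP => [le_n|gt_n]; last first.
  rewrite big1 // => w le_r; suff : (r * period y <= n)%N by rewrite leqNgt gt_n.
  rewrite -(sum_mult w) -card_orbit big_distrr /=; apply: leq_sum => z _.
  case: (boolP (z \in _)) => [z_y|_]; last by rewrite muln0.
  by rewrite muln1 (mult_orbit w n_N z_y).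
set n' := (n - r * period y)%N.
have n'_N : (n'`! %| N)%N by rewrite (dvdn_trans _ n_N) // -(bin_fact (leq_subr (r * period y) n)) dvdn_mull ?dvdn_mulr.
pose add (w : {ffun 'I_n' -> A}) := word_with n (fun z => mult w z + r * (z \in orbit y))%N.
pose del (w : {ffun 'I_n -> A}) := word_with n' (fun z => mult w z - r * (z \in orbit y))%N.
have mult_add w z : mult (add w) z = (mult w z + r * (z \in orbit y))%N.
  rewrite mult_word_with //.
    by rewrite big_split -big_distrr /= sum_mult card_orbit subnK.
  by move=> u; rewrite mult_shift ?mem_orbit_shift.
have le_mult (w : {ffun 'I_n -> A}) : (r <= mult w y)%N -> forall z, (r * (z \in orbit y) <= mult w z)%N.
  move=> le_r z; case: (boolP (z \in _)) => [z_y|_]; last by rewrite muln0.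
  by rewrite muln1 (mult_orbit w n_N z_y).
have mult_del w : (r <= mult w y)%N ->
    forall z, mult (del w) z = (mult w z - r * (z \in orbit y))%N.
  move=> le_r; apply: mult_word_with => //.
    by rewrite sumnB => [|z _]; [rewrite sum_mult -big_distrr /= card_orbit | apply: le_mult].
  by move=> u; rewrite mult_shift ?mem_orbit_shift.
rewrite (reindex_onto add del) => [|w le_r]; last first.
  apply: word_with_mult => // z; rewrite mult_del // subnK //.
  exact: le_mult.
rewrite (eq_bigl xpredT) => [|w]; last first.
  rewrite mult_add fingraph.in_orbit muln1 leq_addl; apply/eqP.
  by apply: word_with_mult => // z; rewrite mult_add addnK.
rewrite (eq_bigr (fun w => word_wt w * orbit_wt y ^+ r)) => [|w _].
  by rewrite -mulr_suml sum_word_wt // mul1r.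
rewrite !word_wtE // -prod_orbit [X in _ * X]big_mkcond -big_split /=.
apply: eq_bigr => z _; rewrite mult_add exprD.
by case: (z \in _); rewrite ?muln1 ?muln0.
Qed.

(** * Expected number of fixed points of the powers *)

(** Whether the [i]-th power of [std w] is increasing or decreasing on the positions
    with itinerary [y] only depends on the parity of the number of reversing
    letters among the first [i] letters of [y]. *)
Fixpoint increasing_iter i (y : N.-tuple A) : bool :=
  if i is i'.+1 then up (head a0 y) == increasing_iter i' (shift y) else true.

Lemma std_iter_monotone n (w : {ffun 'I_n -> A}) i (x z : 'I_n) : (n`! %| N)%N ->
  itin w x = itin w z -> (x < z)%N ->
  (if increasing_iter i (itin w x) then iter i (std w) x < iter i (std w) z
   else iter i (std w) z < iter i (std w) x)%N.
Proof.
move=> n_N; elim: i x z => //= i IHi x z Exz lt_xz.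
have Es : itin w (std w x) = itin w (std w z) by rewrite !itin_std // Exz.
have Ew : w (std w x) = w (std w z) by rewrite -!head_itin Exz.
rewrite -itin_std // head_itin -!iterS !iterSr.
have [|[_]] := stdP w lt_xz; first by rewrite Ew ltnn.
by case: (up _) => lt_s; have := IHi _ _ _ lt_s; rewrite Es => /(_ erefl); case: increasing_iter.
Qed.

(** The [i]-th power maps positions of itinerary [y] to positions of itinerary
    [iter i shift y]: it has fixed points in this class only if the period of [y]
    divides [i], and is then a monotone bijection of the class. *)
Lemma card_fixed_class n (w : {ffun 'I_n -> A}) i y : (n`! %| N)%N ->
  #|[pred x | (iter i (std w) x == x) && (itin w x == y)]| =
  if (period y %| i)%N
  then (if increasing_iter i y then mult w y else odd (mult w y) : nat) else 0%N.
Proof.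
move=> n_N; rewrite -(iter_eq_order shift_inj); case: eqP => [y_per|yNper]; last first.
  apply: eq_card0 => x; rewrite !inE; apply/negP => /andP[/eqP x_fix /eqP x_y].
  by apply: yNper; rewrite -x_y -itin_iter // x_fix.
pose e := [seq x <- enum 'I_n | itin w x == y]; pose t := iter i (std w).
have mem_e x : (x \in e) = (itin w x == y) by rewrite mem_filter mem_enum andbT.
have e_uniq : uniq e by rewrite filter_uniq ?enum_uniq.
have e_incr : pairwise (fun x z : 'I_n => x < z)%N e by apply/pairwise_filter/pairwise_enum_ord.
have size_e : size e = mult w y by rewrite /mult count_map size_filter.
have t_inj : injective t.
  by rewrite /t; elim: (i) => // j IHj x z /perm_inj/IHj.
have itin_t x : itin w (t x) = iter i shift (itin w x) by rewrite itin_iter.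
have t_e x : x \in e -> t x \in e by rewrite !mem_e itin_t => /eqP->; rewrite y_per.
have t_perm : perm_eq (map t e) e.
  have t_sub : {subset map t e <= e} by move=> _ /mapP[x x_e ->]; apply: t_e.
  have te_uniq : uniq (map t e) by rewrite map_inj_uniq.
  have [|_ eq_te] := uniq_min_size te_uniq t_sub; first by rewrite size_map.
  exact: uniq_perm.
have -> : #|[pred x | (iter i (std w) x == x) && (itin w x == y)]| = count (fun x => t x == x) e.
  by rewrite count_filter enumT cardE /enum_mem size_filter; apply: eq_count => x.
have t_mono x z : x \in e -> z \in e -> (x < z)%N ->
    (if increasing_iter i y then t x < t z else t z < t x)%N.
  rewrite !mem_e => /eqP x_y /eqP z_y; rewrite -x_y; apply: std_iter_monotone => //.
  by rewrite x_y z_y.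
case: ifP t_mono => _ t_mono.
  rewrite -size_e; apply/eqP; rewrite -all_count; apply/allP => x x_e; apply/eqP.
  exact: (increasing_fixed e_incr t_perm).
by rewrite -size_e (decreasing_count_fixed e_incr t_perm).
Qed.

Definition sg a : R := if up a then 1 else -1.

Lemma sg_increasing_iter i y :
  \prod_(t < i) sg (head a0 (iter t shift y)) = if increasing_iter i y then 1 else -1.
Proof.
elim: i y => [|i IHi] y; first by rewrite big_ord0.
rewrite big_ord_recl; under eq_bigr => t _ do rewrite lift0 iterSr.
rewrite IHi /sg /=; case: up; case: increasing_iter => /=; rewrite ?mul1r ?mulr1 //.
by rewrite mulrNN mulr1.
Qed.

(** This turns both cases of [card_fixed_class] into sums over the events that [y]
    occurs at least [r] times, whose probabilities are known. *)
Lemma sum_alternating (b : bool) k n : (k <= n)%N ->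
  \sum_(1 <= r < n.+1) (r <= k)%N%:R * (if b then 1 else -1 : R) ^+ r.-1
  = (if b then k else odd k)%:R.
Proof.
move=> le_kn; rewrite (big_cat_nat (n := k.+1)) //= [X in _ + X]big_nat [X in _ + X]big1 ?addr0; last first.
  by move=> r /andP[lt_kr _]; rewrite leqNgt lt_kr mul0r.
rewrite (eq_big_nat _ _ (F2 := fun r => (if b then 1 else -1 : R) ^+ r.-1)); last first.
  by move=> r /andP[_ le_r]; rewrite -ltnS le_r mul1r.
elim: k {le_kn} => [|k IHk]; first by rewrite big_geq //; case: b.
rewrite big_nat_recr //= IHk; case: b {IHk}; first by rewrite expr1n natr1.
by rewrite -signr_odd; case: (odd k); rewrite /= ?expr1 ?expr0 ?addrN ?add0r.
Qed.

Definition sg_iter i y := \prod_(t < i) sg (head a0 (iter t shift y)).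

Lemma card_fixed_sum n (w : {ffun 'I_n -> A}) i : (n`! %| N)%N ->
  #|[pred x | iter i (std w) x == x]|%:R =
  \sum_(y | (period y %| i)%N) \sum_(1 <= r < n.+1)
     (r <= mult w y)%N%:R * sg_iter i y ^+ r.-1.
Proof.
move=> n_N; rewrite -sum1_card (partition_big (itin w) xpredT) //= natr_sum [RHS]big_mkcond.
apply: eq_bigr => y _; rewrite sum1_card card_fixed_class //; case: ifP => // _.
rewrite /sg_iter sg_increasing_iter sum_alternating //.
by rewrite -[X in (_ <= X)%N](sum_mult w) (bigD1 y) //= leq_addr.
Qed.

(** The index [l] is [r * period y], where [r] is that of [card_fixed_sum]. *)
Lemma sum_weight_fixed n i : (n`! %| N)%N -> \sum_a wt a = 1 ->
  \sum_(w : {ffun 'I_n -> A}) word_wt w * #|[pred x | iter i (std w) x == x]|%:R =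
  \sum_(1 <= l < n.+1) \sum_(y | (period y %| gcdn i l)%N)
     sg_iter i y ^+ (l %/ period y).-1 * orbit_wt y ^+ (l %/ period y).
Proof.
move=> n_N wt1.
pose phi y r := sg_iter i y ^+ r.-1 * orbit_wt y ^+ r.
transitivity (\sum_(y | (period y %| i)%N) \sum_(1 <= r < n.+1 | (r * period y <= n)%N) phi y r).
  under eq_bigr => w _ do rewrite card_fixed_sum // mulr_sumr.
  rewrite exchange_big /=; apply: eq_bigr => y y_i.
  under eq_bigr => w _ do rewrite mulr_sumr.
  rewrite exchange_big [RHS]big_mkcond /=; apply: eq_bigr => r _.
  under eq_bigr => w _ do rewrite mulrA mulrC mulr_natr mulrb.
  rewrite -mulr_sumr -big_mkcond sum_mult_ge //=.
  by case: ifP; rewrite ?mulr0.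
rewrite [RHS](exchange_big_dep (fun y => period y %| i)%N) /=; last first.
  by move=> l y _; rewrite dvdn_gcd => /andP[].
apply: eq_bigr => y y_i; have per_gt0 := fingraph.order_gt0 shift y.
under [RHS]eq_bigl => l do rewrite dvdn_gcd y_i.
rewrite (sum_multiples (phi y)) // [RHS](big_nat_widen _ _ n.+1) ?ltnS ?leq_div //.
by apply: eq_bigl => r; rewrite ltnS leq_divRL.
Qed.

(** Both sides are odd exactly when [a] is odd and [b] is even. *)
Lemma odd_gcd_exponents a b : (0 < b)%N ->
  odd (a * b.-1) = odd ((b %/ gcdn a b).-1 * gcdn a b).
Proof.
move=> b_gt0; have le_gb : (gcdn a b <= b)%N by rewrite dvdn_leq ?dvdn_gcdr.
rewrite -subn1 -[(b %/ _).-1]subn1 mulnBl mul1n divnK ?dvdn_gcdr // oddM !oddB //.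
have := dvdn_gcd 2 a b; rewrite !dvdn2.
by case: (odd a) (odd b) (odd (gcdn a b)) => [] [] [].
Qed.

(** The sign enters once less than the weight, as in [sum_alternating], where the
    [r]-th occurrence of a sequence contributes the power [r - 1] of its sign. *)
Definition signed_pow k a := sg a ^+ k.-1 * wt a ^+ k.

(** Both sides are powers of the weight and of the sign of one period of [y]. The
    exponents of the weight agree, those of the sign have the same parity. *)
Lemma sg_iter_orbit_wt i l y : (0 < l)%N -> (period y %| gcdn i l)%N ->
  sg_iter i y ^+ (l %/ period y).-1 * orbit_wt y ^+ (l %/ period y) =
  \prod_(t < gcdn i l) signed_pow (l %/ gcdn i l) (head a0 (iter t shift y)).
Proof.
move=> l_gt0 y_g; have per_gt0 := fingraph.order_gt0 shift y.
set k := (l %/ gcdn i l)%N.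
rewrite (prod_iter_period shift_inj (fun y => signed_pow k (head a0 (tval y)))) //.
rewrite /signed_pow big_split /= !prodrXl -/(orbit_wt y).
have y_il := y_g; rewrite dvdn_gcd in y_il; case/andP: y_il => y_i y_l.
rewrite /sg_iter (prod_iter_period shift_inj (fun y => sg (head a0 (tval y)))) //.
set S := \prod_(z <- _) _; set d := period y in per_gt0 y_g y_i y_l *.
rewrite exprMn -!exprM; congr (_ * _); last first.
  by congr (_ ^+ _); rewrite muln_divA // divnK // dvdn_gcdr.
have S_sg m : S ^+ m = S ^+ odd m.
  have S2 : S ^+ 2 = 1.
    by rewrite -prodrXl big1 // => z _; rewrite /sg; case: up; rewrite ?expr1n ?sqrrN ?expr1n.
  by rewrite -{1}(odd_double_half m) exprD -mul2n exprM S2 expr1n mulr1.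
rewrite S_sg [RHS]S_sg; congr (S ^+ nat_of_bool _).
rewrite {}/k; case/dvdnP: y_i => a ->; case/dvdnP: y_l l_gt0 => b ->.
rewrite -muln_gcdl !mulnK // divnMr // muln_gt0 => /andP[b_gt0 _].
exact: odd_gcd_exponents.
Qed.

(** The sequences of period dividing [g] are the repetitions of words of length [g] *)
Lemma sum_periodic (psi : A -> R) g : (0 < g)%N -> (g %| N)%N ->
  \sum_(y | (period y %| g)%N) \prod_(t < g) psi (head a0 (iter t shift y)) =
  (\sum_a psi a) ^+ g.
Proof.
move=> g_gt0 g_N; have lt_mod t : (t %% g < g)%N by rewrite ltn_mod.
have le_gN : (g <= N)%N by rewrite dvdn_leq.
pose rep (v : {ffun 'I_g -> A}) : N.-tuple A := [tuple v (Ordinal (lt_mod t)) | t < N].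
pose base (y : N.-tuple A) : {ffun 'I_g -> A} := [ffun t : 'I_g => head a0 (iter t shift y)].
have head_rep v t : head a0 (iter t shift (rep v)) = v (Ordinal (lt_mod t)).
  have lt_tN : (t %% N < N)%N by rewrite ltn_mod.
  rewrite head_iter_shift -[(t %% N)%N]/(val (Ordinal lt_tN)) -tnth_nth tnth_mktuple.
  by congr (v _); apply: val_inj; rewrite /= modn_dvdm.
have head_inj y z : (forall t, head a0 (iter t shift y) = head a0 (iter t shift z)) -> y = z.
  move=> yz; apply: eq_from_tnth => t; rewrite !(tnth_nth a0).
  by have := yz t; rewrite !head_iter_shift modn_small.
have repK : cancel rep base.
  move=> v; apply/ffunP => t; rewrite ffunE head_rep.
  by congr (v _); apply: val_inj; rewrite /= modn_small.
rewrite (reindex_onto rep base) => [|y]; last first.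
  rewrite -(iter_eq_order shift_inj) => /eqP y_per; apply: head_inj => t.
  by rewrite head_rep ffunE /= [in RHS](divn_eq t g) addnC iterD iter_mul_fixed.
rewrite (eq_bigl xpredT) => [|v]; last first.
  rewrite repK eqxx andbT -(iter_eq_order shift_inj); apply/eqP/head_inj => t.
  by rewrite -iterD !head_rep; congr (v _); apply: val_inj; rewrite /= modnDr.
rewrite -[g in RHS]card_ord -prodr_const (bigA_distr_bigA (fun _ => psi)).
apply: eq_bigr => v _; apply: eq_bigr => t _; rewrite head_rep.
by congr (psi (v _)); apply: val_inj; rewrite /= modn_small.
Qed.

End Weights.
End Itineraries.

(** Every length [l] that occurs is at most [n], so that sequences of [n`!] terms
    accommodate both the itineraries and the words of length [gcdn i l]. *)
Lemma expected_fixed (R : comNzRingType) (wt : A -> R) n i :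
  \sum_a wt a = 1 ->
  \sum_(w : {ffun 'I_n -> A}) word_wt wt w * #|[pred x | iter i (std w) x == x]|%:R =
  \sum_(1 <= l < n.+1) (\sum_a signed_pow wt (l %/ gcdn i l) a) ^+ gcdn i l.
Proof.
move=> wt1; have [a0 _|A0] := pickP (fun _ : A => true); last first.
  by move/eqP: wt1; rewrite big_pred0 // eq_sym oner_eq0.
have N_gt0 := fact_gt0 n.
rewrite (sum_weight_fixed a0 N_gt0) // big_nat [RHS]big_nat.
apply: eq_bigr => l /andP[l_gt0 le_l].
rewrite -(sum_periodic a0 N_gt0) ?gcdn_gt0 ?l_gt0 ?orbT //.
  by apply: eq_bigr => y y_g; rewrite sg_iter_orbit_wt.
by rewrite (dvdn_trans (dvdn_gcdr i l)) // dvdn_fact // l_gt0.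
Qed.

End SignedAlphabet.

(** * The shelf shuffle as a standardization *)

Section ShelfDeck.

Variable m : nat.
Notation letter := ('I_m * bool)%type.

Definition letter_code (a : letter) : nat := (a.1 * 2 + ~~ a.2)%N.

Lemma letter_code_inj : injective letter_code.
Proof.
by move=> [a b] [c d]; rewrite /letter_code /=; case: b; case: d => E; congr pair; try lia; apply: val_inj => /=; lia.
Qed.

(** Cards are dealt in decreasing order: those put on top end up in increasing
    order, those put at the bottom in decreasing order. *)
Lemma shelf_pilesE n (w : shelf_choices n m) (s : 'I_m) :
  shelf_piles w s = [seq c <- enum 'I_n | w c == (s, true)]
                      ++ rev [seq c <- enum 'I_n | w c == (s, false)].
Proof.
rewrite /shelf_piles foldl_rev; elim: (enum 'I_n) => //= c l IHl.
rewrite /deal_card IHl; case: (w c) => s' b /=.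
rewrite !xpair_eqE [s == s']eq_sym; case: (s' == s); case: b => //=.
by rewrite rev_cons -rcons_cat.
Qed.

Notation std := (std letter_code (fun a : letter => a.2)).

(** Both sides are the cards sorted by letter, and there is only one such list. *)
Lemma shuffled_deck_std n (w : shelf_choices n m) :
  shuffled_deck w = [seq std w j | j <- enum 'I_n].
Proof.
rewrite map_std; apply: (pairwise_eq (@letter_le_anti _ letter_code (fun a : letter => a.2) _ w)).
- have mem_pile s c : c \in shelf_piles w s -> (w c).1 = s.
    by rewrite shelf_pilesE mem_cat mem_rev !mem_filter => /orP[] /andP[/eqP-> _].
  rewrite /shuffled_deck; elim: (enum 'I_m) (pairwise_enum_ord m) => //= s ss IHss.
  case/andP=> /allP lt_s /IHss; rewrite pairwise_cat => ->; rewrite andbT; apply/andP; split.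
    apply/allrelP => c d /mem_pile w_c /flatten_mapP[t /lt_s lt_st /mem_pile w_d].
    by rewrite /letter_le /letter_code w_c w_d; apply/orP; left; lia.
  rewrite shelf_pilesE pairwise_cat; apply/and3P; split.
  + apply/allrelP => c d; rewrite mem_rev !mem_filter => /andP[/eqP w_c _] /andP[/eqP w_d _].
    by rewrite /letter_le /letter_code w_c w_d /=; apply/orP; left; lia.
  + move: (pairwise_filter (fun c => w c == (s, true)) (pairwise_enum_ord n)).
    apply: (sub_in_pairwise _ (filter_all _ _)) => c d /eqP w_c /eqP w_d lt_cd.
    by rewrite /letter_le w_c w_d eqxx /= (ltnW lt_cd) orbT.
  have := pairwise_filter (fun c => w c == (s, false)) (pairwise_enum_ord n).
  have := filter_all (fun c => w c == (s, false)) (enum 'I_n).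
  elim: (filter _ _) => //= c l IHl /andP[/eqP w_c /[dup] /allP all_l /IHl{}IHl] /andP[/allP lt_c /IHl].
  rewrite rev_cons pairwise_rcons => ->; rewrite andbT; apply/allP => d; rewrite mem_rev => d_l.
  have /eqP w_d := all_l d d_l.
  by rewrite /letter_le w_c w_d eqxx /= (ltnW (lt_c d d_l)) orbT.
- rewrite -sorted_pairwise; last exact: letter_le_trans.
  by apply: sort_sorted; apply: letter_le_total; apply: letter_code_inj.
by rewrite (perm_trans (perm_shuffled_deck w)) // perm_sym perm_std_seq.
Qed.

Variable R : realFieldType.
Variable p : R.

Definition letter_wt (a : letter) : R := m%:R^-1 * (if a.2 then p else 1 - p).

Lemma nu_expectationE n (X : 'S_n -> R) :
  nu_expectation m p X =
    \sum_(w : {ffun 'I_n -> letter}) word_wt letter_wt w * X (std w).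
Proof.
rewrite /nu_expectation /nu; under eq_bigr => s _ do rewrite mulr_suml.
rewrite (exchange_big_dep xpredT) //=; apply: eq_bigr => w _.
rewrite (big_pred1 (std w)) // => s; rewrite shuffled_deck_std /=.
apply/eqP/eqP => [/eq_in_map E|-> //].
by apply/permP => j; rewrite E ?mem_enum.
Qed.

Hypothesis m_gt0 : (0 < m)%N.

Lemma sum_letter_wt : \sum_a letter_wt a = 1.
Proof.
rewrite -(pair_bigA _ (fun s b => letter_wt (s, b))) /= /letter_wt /=.
under eq_bigr => s _ do rewrite big_bool /= -mulrDr addrC subrK mulr1.
by rewrite sumr_const card_ord -[_^-1 *+ m]mulr_natr mulVf // pnatr_eq0 -lt0n.
Qed.

(** Each shelf contributes p^k + (-1)^(k-1) q^k, divided by m^k. *)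
Lemma sum_signed_letter_wt k : (0 < k)%N ->
  \sum_a signed_pow (fun a : letter => a.2) letter_wt k a
  = m%:R ^ (1 - k%:Z) * (p ^+ k - (- (1 - p)) ^+ k).
Proof.
move=> k_gt0; have m0 : m%:R != 0 :> R by rewrite pnatr_eq0 -lt0n.
rewrite -(pair_bigA _ (fun s b => signed_pow (fun a : letter => a.2) letter_wt k (s, b))) /=.
under eq_bigr => s _ do rewrite big_bool /signed_pow /sg /letter_wt /= expr1n mul1r.
rewrite sumr_const card_ord -[LHS]mulr_natl expfzDr // expr1z -mulrA; congr (_ * _).
rewrite -exprnN !exprMn exprVn mulrCA -mulrDr; congr (_ * (_ + _)).
case: k k_gt0 => // k _.
by rewrite [in RHS]exprNn [in RHS]exprS mulN1r mulNr opprK.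
Qed.

(** For fixed [l], the function of [f] whose Moebius transform at a divisor [d] of
    [l] is [B_coef m p d (l %/ d)] *)
Definition B_summatory f l : R :=
  m%:R ^ (f%:Z - l%:Z) * (p ^+ (l %/ f) - (- (1 - p)) ^+ (l %/ f)) ^+ f.

Lemma B_coefE d l : (0 < d)%N -> (d %| l)%N ->
  B_coef m p d (l %/ d) = \sum_(e <- divisors d) (moebius e)%:~R * B_summatory (d %/ e) l.
Proof.
move=> d_gt0 /dvdnP[r ->]; rewrite mulnK // /B_coef; apply: eq_big_seq => e.
rewrite -dvdn_divisors // => e_d; have e_gt0 := dvdn_gt0 d_gt0 e_d.
rewrite /B_summatory; have -> : (r * d %/ (d %/ e) = e * r)%N.
  by rewrite -{1}(divnK e_d) mulnA mulnAC mulnK 1?mulnC // divn_gt0 // dvdn_leq.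
by rewrite -mulrA [(r * d)%N]mulnC.
Qed.

Lemma signed_letter_wt_gcd i l : (0 < l)%N ->
  (\sum_a signed_pow (fun a : letter => a.2) letter_wt (l %/ gcdn i l) a) ^+ gcdn i l
  = \sum_(d <- divisors (gcdn i l)) B_coef m p d (l %/ d).
Proof.
move=> l_gt0; have g_gt0 : (0 < gcdn i l)%N by rewrite gcdn_gt0 l_gt0 orbT.
set g := gcdn i l in g_gt0 *; have g_l : (g %| l)%N by rewrite dvdn_gcdr.
have k_gt0 : (0 < l %/ g)%N by rewrite divn_gt0 // dvdn_leq.
transitivity (B_summatory g l).
  rewrite sum_signed_letter_wt // exprMn /B_summatory; congr (_ * _).
  rewrite exprnP exprz_exp; congr (_ ^ _).
  by rewrite mulrBl mul1r -PoszM divnK.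
rewrite -(sum_divisors_moebius (B_summatory ^~ l)) //; apply: eq_big_seq => d.
rewrite -dvdn_divisors // => d_g; rewrite B_coefE ?(dvdn_gt0 g_gt0) //.
exact: dvdn_trans g_l.
Qed.

End ShelfDeck.

(** * From fixed points of powers to cycles *)

Lemma card_fixed_cycle_count n (s : 'S_n) i : (0 < i)%N ->
  #|[pred x | iter i s x == x]| = (\sum_(d <- divisors i) d * cycle_count d s)%N.
Proof.
move=> i_gt0.
have fixE x : (iter i s x == x) = (#|porbit s x| %| i)%N.
  rewrite (iter_eq_order (@perm_inj _ s)); congr (_ %| i)%N; apply: eq_card => y.
  rewrite [LHS]fconnect_orbit; apply/idP/porbitP => [/trajectP[t _ ->]|[t ->]].
    by exists t; rewrite permX.
  by rewrite -fconnect_orbit permX fconnect_iter.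
rewrite -sum1_card (partition_big (porbit s) (fun C => C \in porbits s)) => [|x _]; last exact: imset_f.
transitivity (\sum_(C in porbits s) (#|C| %| i) * #|C|)%N.
  apply: eq_bigr => _ /imsetP[z _ ->]; rewrite -[X in (_ * X)%N]sum1_card big_distrr [RHS]big_mkcond [LHS]big_mkcond /=.
  apply: eq_bigr => x _; rewrite inE fixE eq_porbit_mem.
  case: (boolP (x \in _)) => [|_]; last by rewrite andbF.
  by rewrite -eq_porbit_mem => /eqP->; rewrite andbT muln1; case: (_ %| _)%N.
under [RHS]eq_bigr => d _ do rewrite /cycle_count -sum1_card big_distrr /=.
rewrite [RHS](exchange_big_dep (fun C => C \in porbits s)) /=; last by move=> d C _; rewrite inE => /andP[].
apply: eq_bigr => C C_s; under eq_bigl => d do rewrite inE C_s eq_sym.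
under eq_bigr do rewrite muln1; rewrite -big_filter.
case: (boolP (#|C| %| i)%N) => C_i.
  rewrite filter_pred1_uniq ?divisors_uniq ?big_seq1 ?mul1n //.
  by rewrite -dvdn_divisors.
rewrite big1_seq // => d; rewrite mem_filter -dvdn_divisors //= => /andP[/eqP-> C_i'].
by rewrite C_i' in C_i.
Qed.

Section Corollary.

Variables (R : realFieldType) (m : nat) (p : R).
Hypothesis m_gt0 : (0 < m)%N.

Notation expected_cycles n i :=
  (nu_expectation m p (fun s : 'S_n => (cycle_count i s)%:R)).

(** By [divisor_sums_inj], it suffices to compare the sums of both sides over the
    divisors of [i]; that of the left-hand side is the expected number of fixed
    points of the [i]-th power. *)
Lemma expected_cyclesE n i : (0 < i)%N ->
  i%:R * expected_cycles n i = \sum_(1 <= r < (n %/ i).+1) B_coef m p i r.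
Proof.
move: i; apply: divisor_sums_inj => i i_gt0.
transitivity (nu_expectation m p (fun s : 'S_n => #|[pred x | iter i s x == x]|%:R)).
  rewrite [RHS]/nu_expectation; under [RHS]eq_bigr => s _ do
    rewrite card_fixed_cycle_count // natr_sum mulr_sumr.
  rewrite [RHS]exchange_big; apply: eq_bigr => d _; rewrite /nu_expectation mulr_sumr.
  by apply: eq_bigr => s _; rewrite natrM mulrCA.
rewrite nu_expectationE (expected_fixed _ (@letter_code_inj m)); last exact: sum_letter_wt.
transitivity (\sum_(1 <= l < n.+1) \sum_(d <- divisors i | (d %| l)%N) B_coef m p d (l %/ d)).
  rewrite big_nat [RHS]big_nat; apply: eq_bigr => l /andP[l_gt0 _].
  rewrite signed_letter_wt_gcd // -[RHS]big_filter; apply: perm_big.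
  apply: uniq_perm; rewrite ?filter_uniq ?divisors_uniq // => d.
  by rewrite mem_filter -!dvdn_divisors ?gcdn_gt0 ?i_gt0 // dvdn_gcd andbC.
rewrite (exchange_big_dep xpredT) //=; apply: eq_big_seq => d.
rewrite -dvdn_divisors // => /(dvdn_gt0 i_gt0) d_gt0.
exact: sum_multiples.
Qed.

End Corollary.

(** * Generating function *)

Lemma fps_inv_1subX (F : fieldType) k :
  fps_inv (fps_sub (fps_mono 1 0) (fps_mono 1 1)) k = 1 :> F.
Proof.
set f := fps_sub _ _; have f0 : f 0%N = 1 by rewrite /f /fps_sub /fps_mono subr0.
have f1 : f 1%N = -1 by rewrite /f /fps_sub /fps_mono sub0r.
have f2 j : f j.+2 = 0 by rewrite /f /fps_sub /fps_mono subr0.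
have inv_eq : fps_mul f (fps_inv f) =1 fps_mono 1 0 by apply: fps_mulV; rewrite f0 oner_eq0.
elim: k => [|k IHk].
  by have := inv_eq 0%N; rewrite /fps_mul big_ord1 f0 mul1r.
have := inv_eq k.+1; rewrite /fps_mul 2!big_ord_recl big1 => [|j _]; last by rewrite f2 mul0r.
by rewrite /= f0 f1 mul1r mulN1r addr0 subSS !subn0 IHk => /eqP; rewrite subr_eq0 => /eqP.
Qed.

Theorem corollary2p3 (R : realFieldType) (m : nat) (p : R) (i : nat)
    (hm : (1 <= m)%N) (hp : 0 < p < 1) (hi : (1 <= i)%N) :
  (fps_sum 0 (fun n =>
     fps_mono (nu_expectation m p (fun s : 'S_n => (cycle_count i s)%:R)) n)
   =1 fps_mul
        (fps_inv (fps_sub (fps_mono 1 0) (fps_mono 1 1)))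
        (fps_sum 1 (fun r => fps_mono (B_coef m p i r / i%:R) (i * r))))
  /\ (forall n : nat,
        nu_expectation m p (fun s : 'S_n => (cycle_count i s)%:R)
        = i%:R^-1 * \sum_(1 <= r < (n %/ i).+1) B_coef m p i r).
Proof.
have i0 : i%:R != 0 :> R by rewrite pnatr_eq0 -lt0n.
have expectation n : nu_expectation m p (fun s : 'S_n => (cycle_count i s)%:R)
    = i%:R^-1 * \sum_(1 <= r < (n %/ i).+1) B_coef m p i r.
  by rewrite -expected_cyclesE // mulKf.
split=> // n; rewrite /fps_sum /fps_mono big_nat_recr //= eqxx big_nat big1 ?add0r; last first.
  by move=> k /andP[_ lt_k]; rewrite gtn_eqF.
rewrite expectation -(sum_multiples _ _ hi) /fps_mul.
under [RHS]eq_bigr => k _ do rewrite fps_inv_1subX mul1r.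
(* The right-hand side is a partial sum of coefficients, and the coefficient of
   index j vanishes unless i divides j. *)
rewrite (reindex_inj rev_ord_inj) /=.
under [RHS]eq_bigr => k _ do rewrite subSS (subKn (ltn_ord k : (k <= n)%N)).
rewrite -(big_mkord xpredT (fun j => \sum_(1 <= r < j.+1)
  (if j == (i * r)%N then B_coef m p i r / i%:R else 0))).
rewrite [RHS]big_ltn // [X in X + _]big_geq // add0r.
rewrite [X in _ * X]big_mkcond mulr_sumr [LHS]big_nat [RHS]big_nat.
apply: eq_bigr => j /andP[j_gt0 _]; rewrite -big_mkcond.
case: (boolP (i %| j)%N) => [/dvdnP[q j_q]|i_j]; last first.
  by rewrite mulr0 big1 // => r /eqP j_r; rewrite j_r dvdn_mulr in i_j.
rewrite (eq_bigl (pred1 q)) => [|r]; last by rewrite j_q mulnC eqn_pmul2l // eq_sym.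
rewrite -big_filter filter_pred1_uniq ?iota_uniq ?big_seq1 //; last first.
  move: j_gt0; rewrite mem_index_iota ltnS j_q muln_gt0 => /andP[-> _].
  by rewrite leq_pmulr.
by rewrite j_q mulnK // mulrC.
Qed.
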